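(* Let $1\le a<b$ and let $M$ be a fixed number of machines with $M>\frac{b}{a}$. Among all instances of the Permutation Flowshop Scheduling Problem with $M$ machines, any number $N\ge 1$ of jobs, and integer processing times $t_{i,j}$ in the range $[a,b]$, there are only finitely many for which $$(N+M-1)(b-a)+1 > UB_H - LB_M^+ + 1.$$
   Context: An instance of the Permutation Flowshop Scheduling Problem with $N$ jobs and $M$ machines is given by a matrix of processing times $(t_{i,j})_{1\le i\le M,\,1\le j\le N}$, where $t_{i,j}$ is the processing time of job $j$ on machine $i$. For such an instance define $$UB_H=\sum_{1\le i\le M}\ \sum_{1\le j\le N} t_{i,j},$$ $$LB_M^+=\max_{1\le i\le M}\left\{\min_{1\le j\le N}\sum_{i'<i}t_{i',j}+\sum_{1\le j\le N}t_{i,j}+\min_{1\le j\le N}\sum_{i'>i}t_{i',j}\right\},$$ where $i'$ ranges over the machines $1,\dots,M$ and empty sums are $0$. *)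

(* Defs.v *)
From HB Require Import structures.
From mathcomp Require Import all_boot all_order all_algebra.
From mathcomp Require Import boolp classical_sets cardinality reals.

Set Implicit Arguments.
Unset Strict Implicit.
Unset Printing Implicit Defensive.

Import Order.TTheory GRing.Theory Num.Theory.
Local Open Scope ring_scope.

(* The integers have no top or bottom element to start the iteration from, so it
   starts from the first value of [F], which is harmless when [0 < n]; for
   [n = 0] the result is the junk value 0. *)
Definition min_over n (F : 'I_n -> int) : int :=
  \big[Num.min/head 0 (codom F)]_(i < n) F i.

Definition max_over n (F : 'I_n -> int) : int :=
  \big[Num.max/head 0 (codom F)]_(i < n) F i.

(* Machines index the rows and jobs the columns: [t i j] is the processing time
   of job [j] on machine [i]. *)
Definition UB_H M N (t : 'M[int]_(M, N)) : int :=
  \sum_(i < M) \sum_(j < N) t i j.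

Definition LB_Mplus M N (t : 'M[int]_(M, N)) : int :=
  max_over (fun i : 'I_M =>
    min_over (fun j : 'I_N => \sum_(i' < M | (i' < i)%N) t i' j)
    + \sum_(j < N) t i j
    + min_over (fun j : 'I_N => \sum_(i' < M | (i < i')%N) t i' j)).

Definition pfsp_instance (M : nat) : Type := {N : nat & 'M[int]_(M, N)}.

Definition njobs M (I : pfsp_instance M) : nat := projT1 I.

Definition ptime M (I : pfsp_instance M) : 'M[int]_(M, njobs I) := projT2 I.

(* Main.v *)
Require Import Defs.
From mathcomp Require Import all_boot all_order all_algebra.
From mathcomp Require Import boolp classical_sets cardinality reals.
From mathcomp Require Import lra.

Import Order.TTheory GRing.Theory Num.Theory.
Local Open Scope classical_set_scope.
Local Open Scope ring_scope.

(** Fix a machine [i] attaining the maximum in LB, and any job [j0].  The two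
    minima in the LB-term of [i] are at most their values at [j0], so the term
    is at most the load of machine [i] plus the time job [j0] spends on the
    other machines.  What remains of UB are the operations on the [M - 1] other
    machines of the [N - 1] other jobs ([others_le_UB_sub_LB]), and each takes
    at least [a].  Hence a counted instance has
    [(N - 1) (M - 1) a < (N + M - 1) (b - a)], that is,
    [(N - 1) (M a - b) < M (b - a)].  Since [M a - b > 0], this bounds [N]; and
    for bounded [N] there are finitely many matrices with integer entries in
    [[a, b]] ([finite_bounded_instances]). *)

Lemma min_over_le {n} (F : 'I_n -> int) (j : 'I_n) : min_over F <= F j.
Proof. exact: bigmin_le. Qed.

Lemma max_over_attained {n} (F : 'I_n -> int) :
  (0 < n)%N -> exists i, max_over F = F i.
Proof.
case: n F => // n F _; rewrite /max_over.
elim/big_ind: _ => [|x y [i ->] [j ->]|i _]; last by exists i.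
- (* The starting value of the iteration is [F] at the first index. *)
  by exists ord0; rewrite /codom /image_mem enum_ordSl.
- by case: (leP (F i) (F j)) => _; [exists j | exists i].
Qed.

(** Machines before [i] and machines after [i] together are those other than
    [i], which is how the two minima of LB combine. *)
Lemma sum_before_after {M} (f : 'I_M -> int) (i : 'I_M) :
  \sum_(k < M | (k < i)%N) f k + \sum_(k < M | (i < k)%N) f k
  = \sum_(k < M | k != i) f k.
Proof.
rewrite [RHS](bigID (fun k : 'I_M => (k < i)%N)) /=.
by congr (_ + _); apply: eq_bigl => k; rewrite -val_eqE /=; case: ltngtP.
Qed.

Lemma others_le_UB_sub_LB {M N} (t : 'M[int]_(M, N)) (j0 : 'I_N) :
  (0 < M)%N ->
  exists i, \sum_(k < M | k != i) \sum_(j < N | j != j0) t k j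
            <= UB_H t - LB_Mplus t.
Proof.
move=> M_gt0; rewrite /LB_Mplus; set F := (F in max_over F).
have [i ->] := max_over_attained F M_gt0; exists i.
rewrite lerBrDr /UB_H [leRHS](bigD1 i) //=.
have -> : \sum_(k < M | k != i) \sum_(j < N) t k j =
    \sum_(k < M | k != i) t k j0 +
    \sum_(k < M | k != i) \sum_(j < N | j != j0) t k j.
  by rewrite -big_split /=; apply: eq_bigr => k _; rewrite [LHS](bigD1 j0).
rewrite -(sum_before_after (t ^~ j0)) /F.
have := min_over_le (fun j : 'I_N => \sum_(k < M | (k < i)%N) t k j) j0.
have := min_over_le (fun j : 'I_N => \sum_(k < M | (i < k)%N) t k j) j0.
by move=> /=; lra.
Qed.

Lemma sumr_others_ge {R : numDomainType} {n} (f : 'I_n -> R) (c : R) (i : 'I_n) :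
  (forall k, c <= f k) -> c *+ n.-1 <= \sum_(k < n | k != i) f k.
Proof.
move=> c_le; rewrite -[n in n.-1]card_ord -(cardC1 i) -sumr_const.
exact: ler_sum.
Qed.

(** Such instances are the image of the finite type of pairs of a size below
    [K] and a matrix with entries in ['I_B]. *)
Lemma finite_bounded_instances (M K B : nat) :
  finite_set [set I : pfsp_instance M |
    (njobs I < K)%N /\ forall i j, 0 <= ptime I i j < B%:Z].
Proof.
pose T := {N : 'I_K & 'M['I_B]_(M, N)}.
pose g (x : T) : pfsp_instance M :=
  existT _ (tag x : nat) (map_mx (fun e : 'I_B => (e : nat)%:Z) (tagged x)).
have fin_g : finite_set (g @` [set: T]) by exact/finite_image/finite_finset.
apply: sub_finite_set fin_g.
move=> [N t] /= [ltNK tB].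
have absB i j : (`|t i j| < B)%N.
  by have /andP[t_ge0 t_lt] := tB i j; rewrite -ltz_nat gez0_abs.
exists (existT (fun N : 'I_K => 'M['I_B]_(M, N)) (Ordinal ltNK)
          (\matrix_(i, j) Ordinal (absB i j))) => //.
congr existT; apply/matrixP => i j; rewrite !mxE /=.
by have /andP[t_ge0 _] := tB i j; rewrite gez0_abs.
Qed.

Theorem proposition5 (R : realType) (a b : R) (M : nat) :
  1 <= a -> a < b -> b / a < M%:R ->
  finite_set [set I : pfsp_instance M |
    [/\ (1 <= njobs I)%N,
        (forall (i : 'I_M) (j : 'I_(njobs I)),
            a <= (ptime I i j)%:~R /\ (ptime I i j)%:~R <= b)
      & ((njobs I)%:R + M%:R - 1) * (b - a) + 1
          > (UB_H (ptime I) - LB_Mplus (ptime I))%:~R + 1]].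
Proof.
move=> a_ge1 lt_ab; rewrite ltr_pdivrMr; last by lra.
move=> lt_b_Ma.
have M_gt0 : (0 < M)%N by case: M lt_b_Ma => //; rewrite mul0r; lra.
pose q := M%:R * (b - a) / (M%:R * a - b).
apply: sub_finite_set
  (finite_bounded_instances M (Num.bound q).+1 (Num.bound b)).
move=> [N t] /= [N_gt0 t_ab few].
rewrite /njobs /ptime /= in N_gt0 t_ab few *.
split; last first.
  move=> i j; have [a_le le_b] := t_ab i j; apply/andP; split.
    by rewrite -(ler0z R); lra.
  rewrite -(ltr_int R) (le_lt_trans le_b) //.
  by apply: archi_boundP; lra.
have [i others_le] := others_le_UB_sub_LB t (Ordinal N_gt0) M_gt0.
have a_others : a *+ N.-1 *+ M.-1 <= (UB_H t - LB_Mplus t)%:~R.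
  apply: le_trans (_ : _ <= (\sum_(k < M | k != i)
      \sum_(j < N | j != Ordinal N_gt0) t k j)%:~R) _; last by rewrite ler_int.
  rewrite rmorph_sum /=; apply: sumr_others_ge => k.
  by rewrite rmorph_sum /=; apply: sumr_others_ge => j; case: (t_ab k j).
have N1_lt : (N.-1)%:R < q.
  rewrite ltr_pdivlMr ?subr_gt0 //.
  have pred_natr n : (0 < n)%N -> n%:R = n.-1%:R + 1 :> R.
    by move=> n_gt0; rewrite natr1 prednK.
  move: few a_others; rewrite -mulrnA -[a *+ _]mulr_natr natrM.
  by rewrite (pred_natr N) // (pred_natr M) //; lra.
have q_ge0 : 0 <= q by apply: le_trans (ltW N1_lt); rewrite ler0n.
rewrite -(prednK N_gt0) ltnS -(ltr_nat R).
exact: lt_trans N1_lt (archi_boundP q_ge0).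
Qed.
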